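(* Let $\nu$ be a magnetic potential on $\Gamma_n$ and let $\mathfrak{C}=\{C_j \mid 0\le j\le n\}$ be a coin operator system on $\mathcal{K}$. Let $\mathsf{W}^{(\nu)}=\sum_{j=0}^n \Xi_j^{(\nu)}\otimes C_j$ on $\mathfrak{h}_n\otimes\mathcal{K}$ and $U_\sigma=\sum_{j=0}^n\mathcal{E}_\sigma(j)C_j$ on $\mathcal{K}$ for $\sigma\in\Gamma_n$. Then $$\mathrm{Spec}^{(p)}(\mathsf{W}^{(\nu)})=\bigcup_{\sigma\in\Gamma_n}\mathrm{Spec}^{(p)}(U_\sigma),$$ where $\mathrm{Spec}^{(p)}(T)$ denotes the point-spectrum (the set of all eigenvalues) of an operator $T$.
   Context: Fix an integer $n\ge 0$. $\mathbb{N}_n=\{0,1,\dots,n\}$ and $\Gamma_n$ is the power set of $\mathbb{N}_n$. $\mathfrak{h}_n$ is the complex Hilbert space of dimension $2^{n+1}$ with orthonormal basis $\{Z_\sigma\mid\sigma\in\Gamma_n\}$. For $j\in\mathbb{N}_n$, the operators $\partial_j$ and $\partial_j^*$ on $\mathfrak{h}_n$ are the (mutually adjoint) linear operators determined by $\partial_jZ_\sigma=\mathbf{1}_\sigma(j)Z_{\sigma\setminus\{j\}}$ and $\partial_j^*Z_\sigma=(1-\mathbf{1}_\sigma(j))Z_{\sigma\cup\{j\}}$, where $\mathbf{1}_\sigma$ is the indicator function of $\sigma$. A magnetic potential on $\Gamma_n$ is a function $\nu:\Gamma_n\times\Gamma_n\to[-\pi,\pi]$ with $\nu(\sigma,\tau)=-\nu(\tau,\sigma)$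 for all $\sigma,\tau\in\Gamma_n$. Put $\nu_j=\nu(\{j\},\mathbb{N}_n\setminus\{j\})$ for $j\in\mathbb{N}_n$, and $\Xi_j^{(\nu)}=e^{-\mathrm{i}\nu_j}\partial_j^*+e^{\mathrm{i}\nu_j}\partial_j$, an operator on $\mathfrak{h}_n$. $\mathcal{K}$ is a complex separable Hilbert space (possibly infinite-dimensional) with $\dim\mathcal{K}\ge n+1$. A coin operator system on $\mathcal{K}$ is a family $\{C_j\mid 0\le j\le n\}$ of bounded linear operators on $\mathcal{K}$ such that $\sum_{j=0}^nC_j$ is unitary and $C_j^*C_k=C_jC_k^*=0$ for all $j\ne k$, $0\le j,k\le n$. For $\sigma\in\Gamma_n$ and $j\in\mathbb{N}_n$, $\mathcal{E}_\sigma(j)=2\cdot\mathbf{1}_\sigma(j)-1$, i.e. $1$ if $j\in\sigma$ and $-1$ otherwise. *)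

(* Defs.v *)
From HB Require Import structures.
From mathcomp Require Import all_boot all_order all_algebra.
From mathcomp Require Import sesquilinear complex.
From mathcomp Require Import all_classical all_reals all_analysis.

Set Implicit Arguments.
Unset Strict Implicit.
Unset Printing Implicit Defensive.

Import Order.TTheory GRing.Theory Num.Theory Num.Def numFieldNormedType.Exports.

Local Open Scope classical_set_scope.
Local Open Scope ring_scope.

Definition point_spectrum (F : fieldType) (V : lmodType F) (T : V -> V) :
  set F := [set a | exists2 x : V, x != 0 & T x = a *: x].

Lemma linear_comb2 (F : comNzRingType) (V W : lmodType F) (f g : V -> W)
    (c d : F) :
  linear f -> linear g -> linear (fun u => c *: f u + d *: g u).
Proof.
move=> lf lg a u v; rewrite lf lg !scalerDr !scalerA !(mulrC _ a).
by rewrite addrACA.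
Qed.

(** Operators on a complex Hilbert space: a complete normed space over [R[i]]
    whose norm comes from the inner product [dot], which is linear in its first
    argument and conjugate-linear in its second one. *)

Section Hilbert.
Variables (R : realType) (K : completeNormedModType R[i]).
Variable dot : {dot K for @conjC R[i]}.
Implicit Types S T : K -> K.

Definition hilbert_norm := forall x : K, `|x| ^+ 2 = dot x x.

Definition separable_space := exists2 D : set K, countable D & dense D.

(* The Hilbert dimension of [K] is at least [m]. *)
Definition dim_ge (m : nat) := exists s : m.-tuple K, orthonormal dot s.

Definition bounded_op T := exists M : R[i], forall x, `|T x| <= M * `|x|.

Definition is_adjoint T S := forall x y, dot (T x) y = dot x (S y).

(* [get] picks an arbitrary function if [T] has no adjoint, which the Riesz
   representation theorem excludes for bounded linear operators on a Hilbert
   space. *)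
Definition adjoint T : K -> K := get (is_adjoint T).

Lemma adjoint_unique T S : is_adjoint T S -> adjoint T = S.
Proof.
move=> TS; apply/funext => y; apply/eqP; rewrite -subr_eq0; apply/eqP.
have TA : is_adjoint T (adjoint T) by apply: (@getI _ (is_adjoint T) S).
set d := _ - _; apply/eqP/negPn/negP => d0.
have : 0 < dot d d by apply: neq0_dnorm_gt0.
have e : dot d (adjoint T y) = dot d (S y) by rewrite -TA -TS.
by rewrite {2}/d linearBr [X in X - _]e subrr ltxx.
Qed.

Definition unitary_op T := adjoint T \o T = id /\ T \o adjoint T = id.

Definition coin_system (n : nat) (C : 'I_n.+1 -> {linear K -> K}) :=
  [/\ forall j, bounded_op (C j),
      unitary_op (fun x => \sum_j C j x) &
      forall j k, j != k ->
        adjoint (C j) \o C k = cst 0 /\ C j \o adjoint (C k) = cst 0].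

End Hilbert.

(** [Gam n] is the power set of [{0, ..., n}], and [fock R n] is the space with
    orthonormal basis [Z s], [s : Gam n], a vector being given by its
    coordinates in that basis. *)

Notation Gam n := {set 'I_n.+1}.
Notation fock R n := {ffun Gam n -> R[i]}.

Section Fock.
Variables (R : realType) (n : nat).
Implicit Types (s : Gam n) (u v : fock R n) (j : 'I_n.+1).

Definition Z s : fock R n := [ffun t => (t == s)%:R].

Definition fock_dot u v : R[i] := \sum_s u s * (v s)^*.

Lemma Z_sum u : u = \sum_s u s *: Z s.
Proof.
apply/ffunP => t; rewrite sum_ffunE (bigD1 t) //= big1 => [|s st].
  by rewrite addr0 !ffunE eqxx [_ *: _]mulr1.
by rewrite !ffunE eq_sym (negPf st) [_ *: _]mulr0.
Qed.

Lemma fock_dotZ s t : fock_dot (Z s) (Z t) = (s == t)%:R.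
Proof.
rewrite /fock_dot (bigD1 s) //= !ffunE eqxx mul1r conjC_nat.
by rewrite big1 ?addr0 // => r /negPf rs; rewrite ffunE rs mul0r.
Qed.

(* The linear operator that sends [Z s] to [g s]. *)
Definition lin_ext (g : Gam n -> fock R n) u : fock R n := \sum_s u s *: g s.

Lemma lin_extZ g s : lin_ext g (Z s) = g s.
Proof.
rewrite /lin_ext (bigD1 s) //= ffunE eqxx scale1r.
by rewrite big1 ?addr0 // => r /negPf rs; rewrite ffunE rs scale0r.
Qed.

Lemma lin_ext_is_linear g : linear (lin_ext g).
Proof.
move=> a u v; rewrite /lin_ext scaler_sumr -big_split /=.
by apply: eq_bigr => s _; rewrite !ffunE scalerDl scalerA.
Qed.

Definition annih j := lin_ext (fun s => (j \in s)%:R *: Z (s :\ j)).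

Definition creat j := lin_ext (fun s => (1 - (j \in s)%:R) *: Z (j |: s)).

Lemma annihZ j s : annih j (Z s) = (j \in s)%:R *: Z (s :\ j).
Proof. exact: lin_extZ. Qed.

Lemma creatZ j s : creat j (Z s) = (1 - (j \in s)%:R) *: Z (j |: s).
Proof. exact: lin_extZ. Qed.

Definition magnetic_potential (nu : Gam n -> Gam n -> R) :=
  (forall s t, - pi <= nu s t <= pi) /\ (forall s t, nu s t = - nu t s).

Definition expi (x : R) : R[i] := (cos x +i* sin x)%C.

Definition nu_at (nu : Gam n -> Gam n -> R) j : R :=
  nu [set j]%SET (~: [set j])%SET.

Definition Xi (nu : Gam n -> Gam n -> R) j u : fock R n :=
  expi (- nu_at nu j) *: creat j u + expi (nu_at nu j) *: annih j u.

Lemma Xi_is_linear nu j : linear (Xi nu j).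
Proof.
exact: linear_comb2 (@lin_ext_is_linear _) (@lin_ext_is_linear _).
Qed.

HB.instance Definition _ nu j :=
  GRing.isLinear.Build R[i] (fock R n) (fock R n) *:%R (Xi nu j)
    (Xi_is_linear nu j).

(* The value [E_s(j)], equal to [1] if [j \in s] and to [-1] otherwise. *)
Definition sgn_at s j : R[i] := 2 * (j \in s)%:R - 1.

End Fock.

(** Since [fock R n] has the finite orthonormal basis [Z], the Hilbert tensor
    product of [fock R n] and [K] is the space of all families [F] of vectors
    of [K] indexed by [Gam n], where [F] stands for the sum of the
    [Z s (x) F s], with the inner product [tens_dot] (see [tens_sum] and
    [tens_dot_tens]). *)

Notation fock_tensor n K := {ffun Gam n -> K}.

Section Tensor.
Variables (R : realType) (n : nat) (K : completeNormedModType R[i]).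
Variable dot : {dot K for @conjC R[i]}.
Implicit Types (u v : fock R n) (x y : K) (F G : fock_tensor n K).

Definition tens u x : fock_tensor n K := [ffun s => u s *: x].

Definition tens_dot F G : R[i] := \sum_s dot (F s) (G s).

Definition tens_op (A : fock R n -> fock R n) (B : K -> K) F : fock_tensor n K :=
  \sum_s tens (A (Z R s)) (B (F s)).

Lemma tens_sum F : F = \sum_s tens (Z R s) (F s).
Proof.
apply/ffunP => t; rewrite sum_ffunE (bigD1 t) //= !ffunE eqxx scale1r.
rewrite big1 ?addr0 // => s st.
by rewrite !ffunE eq_sym (negPf st) scale0r.
Qed.

Lemma tens_dot_tens u v x y :
  tens_dot (tens u x) (tens v y) = fock_dot u v * dot x y.
Proof.
rewrite /tens_dot /fock_dot mulr_suml; apply: eq_bigr => s _.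
by rewrite !ffunE linearZl_LR linearZr_LR /= mulrA.
Qed.

Lemma tens_opE (A : {linear fock R n -> fock R n}) (B : {linear K -> K}) u x :
  tens_op A B (tens u x) = tens (A u) (B x).
Proof.
rewrite [in RHS](Z_sum u) linear_sum; apply/ffunP => t.
rewrite /tens_op !sum_ffunE !ffunE sum_ffunE scaler_suml.
by apply: eq_bigr => s _; rewrite linearZ !ffunE linearZ scalerA mulrC.
Qed.

End Tensor.

Section Walk.
Variables (R : realType) (n : nat) (K : completeNormedModType R[i]).
Variable C : 'I_n.+1 -> {linear K -> K}.

Definition walk_op (nu : Gam n -> Gam n -> R) (F : fock_tensor n K) :
  fock_tensor n K := \sum_j tens_op (Xi nu j) (C j) F.

Definition U_op (s : Gam n) (x : K) : K := \sum_j sgn_at R s j *: C j x.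

End Walk.

(* Main.v *)
(** For each [s], the sign characters [t |-> \prod_(j in t) E_s(j)], twisted by
    the phases [expi (nu_j)], are joint eigenvectors of all the [Xi_j], with
    eigenvalue [E_s(j)].  Contracting a vector of the tensor product with such
    a character intertwines the walk with [U_s]; conversely the tensor product
    with it embeds the eigenvectors of [U_s] in those of the walk.  Since the
    characters span, some contraction of an eigenvector of the walk is nonzero. *)
Require Import Defs.
From mathcomp Require Import all_boot all_order all_algebra.
From mathcomp Require Import sesquilinear complex.
From mathcomp Require Import all_classical all_reals all_analysis.

Import Order.TTheory GRing.Theory Num.Theory Num.Def numFieldNormedType.Exports.

Local Open Scope classical_set_scope.
Local Open Scope ring_scope.

Section Phases.
Context {R : realType}.
Implicit Types x : R.

Lemma expiN x : expi (- x) = (expi x)^*.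
Proof. by rewrite /expi cosN sinN. Qed.

Lemma expiM_conj x : expi x * (expi x)^* = 1.
Proof.
apply/eqP; rewrite -expiN /expi cosN sinN eq_complex /=.
by rewrite !mulrN opprK -!expr2 cos2Dsin2 mulrC addrC subrr !eqxx.
Qed.

Lemma expi_neq0 x : expi x != 0.
Proof.
apply/negP => /eqP e; have /esym/eqP := expiM_conj x.
by rewrite e mul0r oner_eq0.
Qed.

End Phases.

Section Signs.
Context {R : realType} {n : nat}.
Implicit Types (s t r : Gam n) (j : 'I_n.+1).

Lemma sgn_atE s j : sgn_at R s j = if j \in s then 1 else -1.
Proof.
rewrite /sgn_at; case: (j \in s); last by rewrite mulr0 sub0r.
by rewrite mulr1 -[2]/(1 + 1) addrK.
Qed.

Lemma sgn_at_sqr s j : sgn_at R s j * sgn_at R s j = 1.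
Proof. by rewrite sgn_atE; case: ifP; rewrite ?mulrNN mulr1. Qed.

Lemma conj_sgn_at s j : (sgn_at R s j)^* = sgn_at R s j.
Proof. by rewrite sgn_atE; case: ifP; rewrite ?rmorphN rmorph1. Qed.

(* Expanding [\prod_j (a_j + b_j)], where [a_j] and [b_j] are the [j]-th factors
   for [j \in s] and for [j \notin s]; [a_j + b_j] vanishes when [j] lies in
   exactly one of [t] and [r]. *)
Lemma sum_sgn_prod t r :
  \sum_s (\prod_(j in t) sgn_at R s j) * (\prod_(j in r) sgn_at R s j)
  = (t == r)%:R * 2 ^+ n.+1.
Proof.
pose b j : R[i] := (-1) ^+ (j \in t) * (-1) ^+ (j \in r).
transitivity (\prod_j (1 + b j)).
  rewrite bigA_distr; apply: eq_bigr => s _.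
  rewrite [in LHS]big_mkcond [X in _ * X = _]big_mkcond -big_split /=.
  apply: eq_bigr => j _; rewrite /b sgn_atE.
  by case: (j \in s); case: (j \in t); case: (j \in r); rewrite ?mulr1 ?mul1r.
case: eqVneq => [tr|tr].
  rewrite mul1r (eq_bigr (fun=> 2)) => [|j _].
    by rewrite prodr_const card_ord.
  by rewrite /b tr -signr_addb addbb.
have /existsP[j jtr] : [exists j, (j \in t) != (j \in r)].
  rewrite -negb_forall; apply: contra tr => /forallP e.
  by apply/eqP/setP => j; apply/eqP.
rewrite mul0r (bigD1 j) //= /b -signr_addb addbC.
have -> : (j \in r) (+) (j \in t) by move: jtr; case: (_ \in _); case: (_ \in _).
by rewrite expr1 subrr mul0r.
Qed.

End Signs.

Section Characters.
Context {R : realType} {n : nat}.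
Variable nu : Gam n -> Gam n -> R.
Implicit Types (s t r : Gam n) (j : 'I_n.+1) (u : fock R n).

Definition flip j t : Gam n := if j \in t then (t :\ j)%SET else (j |: t)%SET.

Lemma in_flip j t : (j \in flip j t) = (j \notin t).
Proof. by rewrite /flip; case: ifP => jt; rewrite !inE eqxx. Qed.

Lemma flipK j : involutive (flip j).
Proof.
move=> t; rewrite {1}/flip in_flip; case: (boolP (j \in t)) => jt.
  by rewrite /flip jt finset.setD1K.
by rewrite /flip (negPf jt) finset.setU1K.
Qed.

(** The only nonzero entry in column [t] of [Xi nu j]: annihilation acts if [j \in t], creation
    otherwise. *)
Definition hop j t : R[i] :=
  if j \in t then expi (nu_at nu j) else (expi (nu_at nu j))^*.

(** Self-adjointness of [Xi nu j] in coordinates. *)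
Lemma hop_flip j t : hop j (flip j t) = (hop j t)^*.
Proof. by rewrite /hop in_flip; case: (j \in t) => //=; rewrite conjCK. Qed.

Lemma XiZ j t : Xi nu j (Z R t) = hop j t *: Z R (flip j t).
Proof.
rewrite /Xi annihZ creatZ expiN /hop /flip; case: (j \in t).
  by rewrite subrr scale0r scaler0 add0r scale1r.
by rewrite subr0 scale1r scale0r scaler0 addr0.
Qed.

Definition fchar s t : R[i] :=
  \prod_(j in t) (sgn_at R s j * expi (nu_at nu j)).

Lemma fcharE s t :
  fchar s t = (\prod_(j in t) sgn_at R s j) * \prod_(j in t) expi (nu_at nu j).
Proof. exact: big_split. Qed.

(** Flipping [j] removes or inserts the factor at [j]; the hop restores or cancels its phase, and a
    sign is its own inverse. Thus [fchar s] is a left eigenvector of [Xi nu j]. *)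
Lemma fchar_hop s j t : hop j t * fchar s (flip j t) = sgn_at R s j * fchar s t.
Proof.
rewrite /hop /flip; case: ifP => jt.
  rewrite [in RHS]/fchar (big_setD1 j) //= -/(fchar s _).
  by rewrite !mulrA sgn_at_sqr mul1r.
rewrite /fchar big_setU1 ?jt //= mulrA; congr (_ * _).
by rewrite mulrC -mulrA expiM_conj mulr1.
Qed.

(** Conjugation turns the left eigenvector into a right one, because [Xi nu j] is self-adjoint. *)
Definition fchar_vec s : fock R n := [ffun t => (fchar s t)^*].

Lemma fchar_vec_set0 s : fchar_vec s finset.set0 = 1.
Proof. by rewrite ffunE /fchar big_set0 rmorph1. Qed.

Lemma Xi_fchar_vec s j : Xi nu j (fchar_vec s) = sgn_at R s j *: fchar_vec s.
Proof.
rewrite [fchar_vec s]Z_sum linear_sum scaler_sumr.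
(* After this reindexing both sides are expansions in the same [Z R t], so coefficients can be
   compared. *)
rewrite [LHS](reindex_inj (inv_inj (flipK j))) /=; apply: eq_bigr => t _.
rewrite linearZ /= XiZ flipK !scalerA hop_flip !ffunE mulrC -rmorphM fchar_hop.
by rewrite rmorphM /= conj_sgn_at.
Qed.

End Characters.

Section Spectrum.
Context {R : realType} {n : nat} {K : completeNormedModType R[i]}.
Variables (nu : Gam n -> Gam n -> R) (C : 'I_n.+1 -> {linear K -> K}).
Implicit Types (s t : Gam n) (F : fock_tensor n K) (x : K).

Definition contract s F : K := \sum_t fchar nu s t *: F t.

Lemma contract_walk s F : contract s (walk_op C nu F) = U_op C s (contract s F).
Proof.
rewrite /contract /U_op /walk_op.
under eq_bigr => t _ do rewrite sum_ffunE scaler_sumr.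
rewrite exchange_big; apply: eq_bigr => j _ /=.
rewrite linear_sum scaler_sumr /tens_op.
under eq_bigr => t _ do rewrite sum_ffunE scaler_sumr.
rewrite exchange_big; apply: eq_bigr => r _ /=.
(* Only [t = flip j r] contributes, since [Xi nu j] maps [Z R r] to a multiple of
   [Z R (flip j r)]. *)
rewrite (bigD1 (flip j r)) //= big1 => [|t /negPf tr].
  rewrite addr0 XiZ linearZ /= !ffunE eqxx /= !scalerA [_ *: 1]mulr1.
  by rewrite mulrC fchar_hop.
by rewrite XiZ !ffunE tr [_ *: 0]mulr0 scale0r scaler0.
Qed.

Lemma walk_fchar_vec s x :
  walk_op C nu (tens (fchar_vec nu s) x) = tens (fchar_vec nu s) (U_op C s x).
Proof.
apply/ffunP => t; rewrite /walk_op /U_op sum_ffunE ffunE scaler_sumr.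
apply: eq_bigr => j _; rewrite tens_opE /= Xi_fchar_vec ffunE.
by rewrite [in LHS]ffunE !scalerA [X in X *: _]mulrC.
Qed.

(** Fourier inversion: the sign products are orthogonal under summation over [s], so weighting the
    contractions by the one for [t] isolates [F t]. *)
Lemma contract_inj F : (forall s, contract s F = 0) -> F = 0.
Proof.
move=> F0; apply/ffunP => t; rewrite ffunE.
have : \sum_s (\prod_(j in t) sgn_at R s j) *: contract s F = 0.
  by rewrite big1 // => s _; rewrite F0 scaler0.
under eq_bigr => s _ do rewrite scaler_sumr.
rewrite exchange_big /=.
under eq_bigr => r _.
  under eq_bigr => s _ do rewrite scalerA fcharE mulrA.
  rewrite -scaler_suml -mulr_suml sum_sgn_prod; over.
rewrite (bigD1 t) //= [X in _ + X]big1 => [|r /negPf rt]; last first.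
  by rewrite eq_sym rt !mul0r scale0r.
(* The coefficient left on [F t] is [2 ^+ n.+1] times a product of phases, hence nonzero. *)
rewrite eqxx mul1r addr0 => /eqP; rewrite scaler_eq0 mulf_eq0 => /orP[|/eqP//].
rewrite expf_eq0 pnatr_eq0 /= => /prodf_eq0[j _].
by rewrite (negPf (expi_neq0 _)).
Qed.

End Spectrum.

Theorem theorem4p5 (R : realType) (n : nat) (K : completeNormedModType R[i])
    (dot : {dot K for @conjC R[i]})
    (hilbertK : hilbert_norm dot)
    (separableK : separable_space K)
    (dimK : dim_ge dot n.+1)
    (nu : Gam n -> Gam n -> R) (hnu : magnetic_potential nu)
    (C : 'I_n.+1 -> {linear K -> K}) (hC : coin_system dot C) :
  point_spectrum (walk_op C nu) = \bigcup_s point_spectrum (U_op C s).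
Proof.
apply/seteqP; split => a.
  move=> [F F0 WF].
  have [s Fs] : exists s, contract nu s F != 0.
    apply/not_existsP => F0'; move/eqP: F0; apply.
    by apply: (@contract_inj _ _ _ nu) => s; apply/eqP/negPn/negP/F0'.
  exists s => //; exists (contract nu s F) => //.
  rewrite -contract_walk WF /contract scaler_sumr.
  by apply: eq_bigr => t _; rewrite ffunE !scalerA mulrC.
move=> [s _ [x x0 Ux]]; exists (tens (fchar_vec nu s) x).
  (* The coordinate of the tensor at the empty set is [x] itself. *)
  apply: contra x0 => /eqP/ffunP/(_ finset.set0).
  by rewrite ffunE fchar_vec_set0 scale1r ffunE => ->.
rewrite walk_fchar_vec Ux; apply/ffunP => t.
by rewrite !ffunE !scalerA mulrC.
Qed.
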